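(* Let ${\bm\delta}=(\delta^A)_{A\in\mathcal A}$ be a family of information delays such that for every $A\in\mathcal A$ the delay information $\mathfrak H^A$ corresponding to $\delta^A$ satisfies $\mathfrak H^A\subseteq\mathfrak F^A$. Then the family $(\mathfrak F^{A,{\bm\delta}})_{A\in\mathcal A}$ is a family of filtrations that agrees with the index system $\mathcal A$, i.e. for all $A_1,A_2\in\mathcal A$ with $A_1\subseteq A_2$ one has $\mathcal F^{A_1,{\bm\delta}}_t\subseteq\mathcal F^{A_2,{\bm\delta}}_t$ for all $t\in[0,T]$.
   Context: Let $T\in(0,\infty]$ and let $(\Omega,\mathcal G,\mathfrak G=(\mathcal G_t)_{t\in[0,T]},\mathbb P)$ be a filtered probability space with $\mathcal G=\mathcal G_T$. Let $I$ be an arbitrary set, and for each finite $A\subseteq I$ let $\mathfrak F^A=(\mathcal F^A_t)_{t\in[0,T]}$ be a filtration with $\mathfrak F^A\subseteq\mathfrak G$ (inclusion of filtrations means inclusion at every time). An index system is a sequence $(\mathcal A^n)_{n\in\mathbb N}$, with $\mathcal A=\bigcup_n\mathcal A^n$, such that (i) $\mathcal A^n\subseteq\{A\subseteq I:|A|=n\}$; (ii) $A_1,A_2\in\mathcal A$ implies $A_1\cup A_2\in\mathcal A$; (iii) $A_1\subseteq A_2$ in $\mathcal A$ implies $\mathfrak F^{A_1}\subseteq\mathfrak F^{A_2}$. A family of filtrations satisfying (iii) is said to agree with the index system. Fix an index system that agrees with $(\mathfrak F^A)$. A pair $(\mathfrak H,\delta)$, with $\mathfrak H=(\mathcal H_t)_{t\in[0,T]}\subseteq\mathfrak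 G$ a filtration (the delay information) and $(\delta(t))_{t\in[0,T]}$ a real-valued process, is an information delay if (i) each $\delta(t)$ is an $\mathfrak H$-stopping time; (ii) $0\le\delta(t)\le t$ for all $t\in[0,T]$; (iii) $\delta(t,\omega)\le\delta(s,\omega)$ for all $0\le t\le s\le T$, $\omega\in\Omega$. If $\mathfrak H\subseteq\mathfrak F^A$, put $\mathcal F^{A,\delta}_t:=\mathcal F^A_{\delta(t)}$, where for a stopping time $\tau$, $\mathcal F^A_\tau=\{F\in\mathcal F^A_T:F\cap\{\tau\le u\}\in\mathcal F^A_u\ \forall u\in[0,T]\}$. For ${\bm\delta}$ as in the claim, $\mathfrak F^{A,{\bm\delta}}=(\mathcal F^{A,{\bm\delta}}_t)_{t\in[0,T]}$ is defined recursively (over $|A|$) by $$\mathcal F^{A,{\bm\delta}}_t=\sigma\Big(\mathcal F^{A,\delta^A}_t\cup\bigcup_{A'\in\mathcal A,\,A'\subsetneq A}\mathcal F^{A',{\bm\delta}}_t\Big).$$ *)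

(* Defs.v *)
From HB Require Import structures.
From mathcomp Require Import all_boot all_order all_algebra.
From mathcomp Require Import finmap.
From mathcomp Require Import all_classical all_reals all_analysis.

Set Implicit Arguments.
Unset Strict Implicit.
Unset Printing Implicit Defensive.

Import Order.TTheory GRing.Theory Num.Theory.
Local Open Scope classical_set_scope.
Local Open Scope ring_scope.
Local Open Scope ereal_scope.

(* A family indexed by the time interval [0, T], T in ]0, +oo], is encoded as
   a function on \bar R whose values outside [0, T] are never inspected.  When
   T = +oo the interval [0, T] contains the point +oo. *)

Section Filtrations.
Context {d : measure_display} {Omega : measurableType d} {R : realType}.
Implicit Types (T t s u : \bar R) (F G H : \bar R -> set (set Omega)).

Definition time T : set (\bar R) := [set t | 0 <= t <= T].

Record filtration T F : Prop := Filtration {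
  filtration_sigma_algebra :
    forall t, time T t -> sigma_algebra [set: Omega] (F t);
  filtration_measurable :
    forall t, time T t -> F t `<=` (@measurable d Omega);
  filtration_nondecreasing :
    forall t s, time T t -> time T s -> t <= s -> F t `<=` F s }.

Definition subfiltration T F G : Prop := forall t, time T t -> F t `<=` G t.

Definition stopping_time T F (tau : Omega -> \bar R) : Prop :=
  forall u, time T u -> F u [set w | tau w <= u].

Definition stopped_sigma_algebra T F (tau : Omega -> \bar R)
    : set (set Omega) :=
  [set B | F T B /\
    forall u, time T u -> F u (B `&` [set w | tau w <= u])].

(* A real-valued process indexed by [0, T], seen at time t as an
   extended-real-valued random time. *)
Definition random_time (delta : \bar R -> Omega -> R) t : Omega -> \bar R :=
  fun w => (delta t w)%:E.

Record information_delay T G H (delta : \bar R -> Omega -> R) : Prop :=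
  InformationDelay {
    delay_filtration : filtration T H;
    delay_subfiltration : subfiltration T H G;
    delay_process :
      forall t, time T t -> measurable_fun [set: Omega] (delta t);
    delay_stopping_time :
      forall t, time T t -> stopping_time T H (random_time delta t);
    delay_bounds :
      forall t w, time T t -> 0 <= (delta t w)%:E <= t;
    delay_nondecreasing :
      forall t s w, time T t -> time T s -> t <= s ->
        (delta t w <= delta s w)%R }.

Section IndexSystems.
Context {I : choiceType}.
Implicit Types (FF : {fset I} -> \bar R -> set (set Omega))
  (AA : set {fset I}) (An : nat -> set {fset I}) (A : {fset I}).

Definition index_sets An : set {fset I} := \bigcup_n An n.

Definition agrees T AA FF : Prop :=
  forall A1 A2, AA A1 -> AA A2 -> (A1 `<=` A2)%fset ->
    subfiltration T (FF A1) (FF A2).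

Record index_system T FF An : Prop := IndexSystem {
  index_system_card : forall n A, An n A -> #|` A| = n;
  index_system_union : forall A1 A2, index_sets An A1 -> index_sets An A2 ->
    index_sets An (A1 `|` A2)%fset;
  index_system_agrees : agrees T (index_sets An) FF }.

Lemma fproper_wf : well_founded (fun A' A : {fset I} => (A' `<` A)%fset).
Proof.
move=> A; have [n] := ubnP #|` A|.
elim: n A => [A|n IHn A ltAn]; first by rewrite ltn0.
constructor=> A' ltA'A; apply: IHn.
exact: leq_trans (fproper_ltn_card ltA'A) ltAn.
Qed.

(* Well-founded recursion on the finite set A; the proof-irrelevant recursion
   equation is delayed_filtrationE below. *)
Definition delayed_filtration T FF AA (delta : {fset I} -> \bar R -> Omega -> R)
    : {fset I} -> \bar R -> set (set Omega) :=
  Fix fproper_wf (fun=> \bar R -> set (set Omega))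
    (fun A rec t =>
      <<s stopped_sigma_algebra T (FF A) (random_time (delta A) t) `|`
          [set B | exists A' (ltA'A : (A' `<` A)%fset),
                     AA A' /\ rec A' ltA'A t B] >>).

Lemma delayed_filtrationE T FF AA delta A t :
  delayed_filtration T FF AA delta A t =
  <<s stopped_sigma_algebra T (FF A) (random_time (delta A) t) `|`
      \bigcup_(A' in [set A' | AA A' /\ (A' `<` A)%fset])
        delayed_filtration T FF AA delta A' t >>.
Proof.
rewrite {1}/delayed_filtration Fix_eq.
  congr (<<s _ `|` _ >>); apply/seteqP; split=> B.
    by move=> [A' [ltA'A [AAA' BA']]]; exists A'.
  by move=> [A' [AAA' ltA'A] BA']; exists A', ltA'A.
move=> {}A f g eq_fg; suff -> : f = g by [].
apply: functional_extensionality_dep => A'.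
by apply: functional_extensionality_dep => ltA'A; exact: eq_fg.
Qed.

End IndexSystems.
End Filtrations.

(* Main.v *)
(* Agreement is built into the recursion.  Monotonicity in time follows by
   induction on [A] from monotonicity of [F_tau] in the stopping time [tau];
   the delays [delta A t] are [H A]-stopping times, hence [F A]-stopping times. *)

Require Import Defs.
From HB Require Import structures.
From mathcomp Require Import all_boot all_order all_algebra.
From mathcomp Require Import finmap.
From mathcomp Require Import all_classical all_reals all_analysis.

Import Order.TTheory GRing.Theory Num.Theory.
Local Open Scope classical_set_scope.
Local Open Scope ring_scope.
Local Open Scope ereal_scope.

Lemma sigma_algebraI (X : Type) (S : set (set X)) (A B : set X) :
  sigma_algebra [set: X] S -> S A -> S B -> S (A `&` B).
Proof.
by move=> /sigma_algebraP[]// _ _ _ SI SA SB; exact: SI.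
Qed.

Lemma stopped_sigma_algebra_measurable (d : measure_display)
    (Omega : measurableType d) (R : realType) (T : \bar R)
    (F : \bar R -> set (set Omega)) (tau : Omega -> \bar R) :
  0 <= T -> filtration T F ->
  stopped_sigma_algebra T F tau `<=` @measurable d Omega.
Proof.
(* Membership in the stopped sigma-algebra includes [F T B], and [T] is itself a point of [time T]
   because [0 <= T], also when [T] is infinite. *)
move=> T0 F_filt B [FTB _]; apply: filtration_measurable F_filt _ _ _ FTB.
by rewrite /time /= T0 lexx.
Qed.

(* If [tau <= sigma] then [{sigma <= u} = {tau <= u} `&` {sigma <= u}]. *)
Lemma stopped_sigma_algebra_le (d : measure_display)
    (Omega : measurableType d) (R : realType) (T : \bar R)
    (F : \bar R -> set (set Omega)) (tau sigma : Omega -> \bar R) :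
  filtration T F -> stopping_time T F sigma ->
  (forall w, tau w <= sigma w) ->
  stopped_sigma_algebra T F tau `<=` stopped_sigma_algebra T F sigma.
Proof.
move=> F_filt sigma_stop tau_le B [FTB FB]; split=> // u Tu.
have <- : [set w | tau w <= u] `&` [set w | sigma w <= u]
    = [set w | sigma w <= u].
  by apply: setIidr => w; exact: le_trans.
rewrite setIA; apply: sigma_algebraI; last exact: sigma_stop.
- exact: filtration_sigma_algebra F_filt _ Tu.
- exact: FB.
Qed.

Section DelayedFiltration.
Context {d : measure_display} {Omega : measurableType d} {R : realType}
  {I : choiceType}.
Context (T : \bar R) (F : {fset I} -> \bar R -> set (set Omega))
  (AA : set {fset I}) (delta : {fset I} -> \bar R -> Omega -> R).

Let FF := delayed_filtration T F AA delta.

(** The generators are measurable: the stopped events lie in [F A T], and those coming from proper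
    subsets are measurable by induction. The generated sigma-algebra is the smallest one containing
    them, so it stays inside [measurable]. *)
Lemma delayed_filtration_measurable (A : {fset I}) (t : \bar R) :
  0 <= T -> (forall A', filtration T (F A')) ->
  FF A t `<=` @measurable d Omega.
Proof.
move=> T0 F_filt; elim/(well_founded_ind (@fproper_wf I)): A => A IH.
rewrite /FF delayed_filtrationE.
apply: smallest_sub; first exact: sigma_algebra_measurable.
rewrite subUset; split; first exact: stopped_sigma_algebra_measurable.
by apply: bigcup_sub => A' [_]; exact: IH.
Qed.

(** The two times enter only through the delays: the order of [t] and [s] is replaced by the
    pointwise order of [delta A' t] and [delta A' s]. The generators at [t] are then included in
    those at [s], piece by piece. *)
Lemma delayed_filtration_le (A : {fset I}) (t s : \bar R) :
  (forall A', AA A' -> filtration T (F A')) ->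
  (forall A', AA A' -> stopping_time T (F A') (random_time (delta A') s)) ->
  (forall A' w, AA A' -> (delta A' t w <= delta A' s w)%R) ->
  AA A -> FF A t `<=` FF A s.
Proof.
move=> F_filt delta_stop delta_le.
(* The premise [AA A] stays inside the induction, since the delays are controlled only for members
   of [AA]. *)
elim/(well_founded_ind (@fproper_wf I)): A => A IH AAA.
rewrite /FF !delayed_filtrationE; apply: sub_sigma_algebra2; apply: setUSS.
  apply: stopped_sigma_algebra_le; [exact: F_filt|exact: delta_stop|].
  by move=> w; rewrite lee_fin delta_le.
by move=> B [A' [AAA' ltA'A] BA']; exists A' => //;
   exact: (IH _ ltA'A AAA' _ BA').
Qed.

Lemma delayed_filtration_agrees : agrees T AA FF.
Proof.
(* The recursion ranges over proper subsets only, so equality is split off; for a proper subset,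
   [FF A1 t] is itself among the generators of [FF A2 t]. *)
move=> A1 A2 AA1 _; rewrite fsubEproper => /predU1P[->|ltA12] t _ B FB //.
by rewrite /FF delayed_filtrationE; apply: sub_sigma_algebra; right; exists A1.
Qed.

End DelayedFiltration.

Theorem lemma3 (R : realType) (T : \bar R) (T_gt0 : 0 < T)
    (d : measure_display) (Omega : measurableType d) (P : probability Omega R)
    (G : \bar R -> set (set Omega))
    (G_filtration : filtration T G)
    (G_terminal : G T = @measurable d Omega)
    (I : choiceType)
    (F : {fset I} -> \bar R -> set (set Omega))
    (F_filtration : forall A : {fset I}, filtration T (F A))
    (F_sub : forall A : {fset I}, subfiltration T (F A) G)
    (An : nat -> set {fset I})
    (An_index_system : index_system T F An)
    (H : {fset I} -> \bar R -> set (set Omega))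
    (delta : {fset I} -> \bar R -> Omega -> R)
    (delta_delay : forall A : {fset I}, index_sets An A ->
      information_delay T G (H A) (delta A))
    (H_sub : forall A : {fset I}, index_sets An A ->
      subfiltration T (H A) (F A)) :
  (forall A : {fset I}, index_sets An A ->
     filtration T (delayed_filtration T F (index_sets An) delta A)) /\
  agrees T (index_sets An)
    (delayed_filtration T F (index_sets An) delta).
Proof.
have T_ge0 := ltW T_gt0.
split; last exact: delayed_filtration_agrees.
move=> A AA; split.
- by move=> t _; rewrite delayed_filtrationE; exact: smallest_sigma_algebra.
- by move=> t _; exact: delayed_filtration_measurable.
- move=> t s Tt Ts le_ts; apply: delayed_filtration_le => //.
  + move=> A' AA' u Tu; apply: H_sub => //.
    exact: (delay_stopping_time (delta_delay _ AA')).
  + by move=> A' w AA'; exact: (delay_nondecreasing (delta_delay _ AA')).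
Qed.
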